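(* Let $v\in(\mathbb R^k)^+\setminus\{0\}$ be a row vector with nonnegative real entries, and let $\phi_v:\mathbb Z^k\to\mathbb R$ be the trace $w\mapsto vw$. Then $\phi_v$ is an order unit good trace if and only if, up to positive scalar multiple and after rearrangement (permutation of the entries) so that $v=(n(1),\dots,n(r);0,0,\dots,0)$ with nonzero entries $n(1),\dots,n(r)$ satisfying $n(i-1)\le n(i)$, we have $n(i)\in\mathbb N$ for all $i\le r$, $n(1)=1$, and for all $1<j\le r$, $$n(j)\le1+\sum_{i<j}n(i).$$
   Context: $\mathbb Z^k$ (columns) carries the usual coordinatewise ordering; its order units are the vectors with all entries strictly positive. $vw$ is matrix multiplication of the row $v$ by the column $w$. A trace $\tau$ of a partially ordered abelian group $G$ (nonzero positive homomorphism to $\mathbb R$) is order unit good if for every order unit $b$ of $G$ and every $a'\in G$ with $0\le\tau(a')\le\tau(b)$ there is $a\in G$ with $0\le a\le b$ and $\tau(a)=\tau(a')$. *)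

(* Defs.v *)
From HB Require Import structures.
From mathcomp Require Import all_boot all_order all_algebra all_fingroup.
From mathcomp Require Import reals.

Set Implicit Arguments.
Unset Strict Implicit.
Unset Printing Implicit Defensive.

Import Order.TTheory GRing.Theory Num.Theory.

Local Open Scope ring_scope.

(* The order of a group is an explicit relation: [porderZmodType] does not
   require the order to be translation invariant, and matrices carry no
   canonical order in the library. *)
Definition po_group (G : zmodType) (le : rel G) : Prop :=
  [/\ reflexive le, antisymmetric le, transitive le &
      forall x y z : G, le x y -> le (x + z) (y + z)].

Definition order_unit (G : zmodType) (le : rel G) (u : G) : Prop :=
  le 0 u /\ forall g : G, exists n : nat, le g (u *+ n).

Definition trace (R : realType) (G : zmodType) (le : rel G) (tau : G -> R) :
    Prop :=
  [/\ zmod_morphism tau,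
      exists g, tau g != 0 &
      forall g, le 0 g -> 0 <= tau g].

Definition order_unit_good (R : realType) (G : zmodType) (le : rel G)
    (tau : G -> R) : Prop :=
  forall b : G, order_unit le b ->
  forall a' : G, 0 <= tau a' <= tau b ->
  exists a : G, [/\ le 0 a, le a b & tau a = tau a'].

Definition order_unit_good_trace (R : realType) (G : zmodType) (le : rel G)
    (tau : G -> R) : Prop :=
  trace le tau /\ order_unit_good le tau.

Definition cV_le (k : nat) : rel 'cV[int]_k :=
  fun x y => [forall i, x i 0 <= y i 0].

Lemma cV_le_po_group (k : nat) : po_group (@cV_le k).
Proof.
split.
- by move=> x; apply/forallP.
- move=> x y /andP[/forallP xy /forallP yx]; apply/colP => i.
  by apply/le_anti; rewrite xy yx.
- move=> y x z /forallP xy /forallP yz; apply/forallP => i.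
  exact: le_trans (xy i) (yz i).
- by move=> x y z /forallP xy; apply/forallP => i; rewrite !mxE lerD2r.
Qed.

Lemma cV_order_unitP (k : nat) (u : 'cV[int]_k) :
  order_unit (@cV_le k) u <-> forall i, 0 < u i 0.
Proof.
split=> [[/forallP u0 uP] i|u0].
  have [n /forallP/(_ i)] := uP (const_mx 1).
  have := u0 i; rewrite !mxE mulmxnE le_eqVlt => /orP[/eqP <-|//].
  by rewrite mul0rn.
split; first by apply/forallP => i; rewrite mxE ltW.
move=> g; exists (\sum_i `|g i 0%R|%N)%N; apply/forallP => i.
rewrite mulmxnE; apply: (le_trans (ler_norm _)).
rewrite -abszE; apply: (@le_trans _ _ (\sum_i `|g i 0%R|%N)%N%:Z).
  by rewrite lez_nat (bigD1 i) //= leq_addr.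
by rewrite -mulr_natr natz ler_peMl // -gtz0_ge1.
Qed.

Definition phi (R : realType) (k : nat) (v : 'rV[R]_k) (w : 'cV[int]_k) : R :=
  (v *m map_mx intr w) 0 0.

(* [n = (n(1), ..., n(r); 0, ..., 0)] with nonzero nondecreasing [n(i)];
   the entry [n(j)] is [n 0 j'] where [j' : 'I_k] has value [j - 1]. *)
Definition normal_form (R : realType) (k : nat) (n : 'rV[R]_k) (r : nat) :
    Prop :=
  (r <= k)%N /\
  [/\ forall i : 'I_k, (i < r)%N -> n 0 i != 0,
      forall i : 'I_k, (r <= i)%N -> n 0 i = 0 &
      forall i j : 'I_k, j = i.+1 :> nat -> (j < r)%N -> n 0 i <= n 0 j].

Definition slow_growth (R : realType) (k : nat) (n : 'rV[R]_k) (r : nat) :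
    Prop :=
  [/\ forall i : 'I_k, (i < r)%N -> n 0 i \is a Num.nat,
      forall i : 'I_k, i = 0%N :> nat -> n 0 i = 1 &
      forall j : 'I_k, (0 < j < r)%N ->
        n 0 j <= 1 + \sum_(i < k | (i < j)%N) n 0 i].

(* Main.v *)
Require Import Defs.
From mathcomp Require Import all_boot all_order all_algebra all_fingroup.
From mathcomp Require Import reals.
From mathcomp Require Import zify.

Import Order.TTheory GRing.Theory Num.Theory.

Local Open Scope ring_scope.

(** Goodness is invariant under scaling and permutation. If the weights satisfy
the growth condition, then every integer up to the total [n b] is a subsum
of [b i] copies of each [n i]: use as many copies of the largest weight as
possible and recurse. Conversely, apply goodness to the order unit
[b = (1, ..., 1)]. The remainder of [n j] modulo the least nonzero weight [1]
is the value of some [0 <= a], and a nonzero such value is at least [1]; so the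
remainder vanishes and [n j] is an integer. If
[1 + \sum_(i < j) n i < n j], the left-hand side is the value of some
[0 <= a <= b], which cannot use any weight from the [j]-th on, and the weights
before it do not suffice. *)

(** Induction on [k]. Taking [N] and [B] on all of [nat] lets the induction drop the last weight
    without casting ordinals. *)
Lemma bounded_change (N B : nat -> nat) (k : nat) :
    (forall i, i < k -> 0 < B i)%N ->
    (forall j, j < k -> N j <= 1 + \sum_(i < j) N i)%N ->
  forall m, (m <= \sum_(i < k) N i * B i)%N ->
  exists a : nat -> nat,
    (forall i, a i <= B i)%N /\ (\sum_(i < k) N i * a i)%N = m.
Proof.
elim: k => [|k IHk] B_gt0 slow m.
  by rewrite big_ord0 leqn0 => /eqP ->; exists (fun=> 0%N); rewrite big_ord0.
rewrite big_ord_recr /= => le_m.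
pose t := minn (B k) (m %/ N k).
have le_sum : (\sum_(i < k) N i <= \sum_(i < k) N i * B i)%N.
  by apply: leq_sum => i _; rewrite leq_pmulr // B_gt0 // ltnW // ltnS.
have tN : (t * N k <= m)%N.
  by rewrite (leq_trans _ (leq_divM m (N k))) // leq_mul2r geq_minr orbT.
have [|||a [aB am]] := IHk _ _ (m - t * N k)%N.
- by move=> i ik; apply: B_gt0; apply: ltnW.
- by move=> j jk; apply: slow; apply: ltnW.
(* If [B k] caps [t], the remainder fits by [le_m]. Otherwise it is [m %% N k], hence below [N k]
   and at most the sum of the earlier weights. If [N k = 0], nothing is subtracted and [le_m]
   suffices. *)
- have slow_k := slow k (leqnn _).
  rewrite /t in tN *; case: (leqP (B k) (m %/ N k)) tN => Bk tN.
    by rewrite leq_subLR addnC mulnC.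
  have [N0|N_gt0] := posnP (N k).
    by move: le_m; rewrite N0 mul0n addn0 muln0 subn0.
  have := ltn_pmod m N_gt0; have := divn_eq m (N k); lia.
exists (fun i => if i == k then t else a i); split.
  by move=> i; case: eqP => [->|_]; rewrite ?geq_minl.
rewrite big_ord_recr /= eqxx (eq_bigr (fun i : 'I_k => N i * a i)%N); last first.
  by move=> i _; rewrite ltn_eqF.
by rewrite am (mulnC (N k)) subnK.
Qed.

(** Sorting the enumeration of ['I_k] only permutes it, and [s] is read off from that
    permutation. *)
Lemma sorting_perm (k : nat) (e : rel 'I_k) :
    total e -> transitive e ->
  exists s : 'S_k, forall i j : 'I_k, (i <= j)%N -> e (s i) (s j).
Proof.
move=> e_total e_trans.
have /tuple_permP[s sE] : perm_eq (sort e (ord_tuple k)) (ord_tuple k).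
  by rewrite perm_sort.
exists s => i j le_ij.
have e_refl : reflexive e by move=> x; have := e_total x x; rewrite orbb.
have nthE (l : 'I_k) : nth i (sort e (ord_tuple k)) l = s l.
  by rewrite sE -tnth_nth tnth_mktuple tnth_ord_tuple.
rewrite -!nthE; apply: sorted_leq_nth => //; first exact: sort_sorted.
- by rewrite inE size_sort size_tuple.
- by rewrite inE size_sort size_tuple.
Qed.

Lemma initial_segmentP (k : nat) (p : pred 'I_k) :
    (forall i j : 'I_k, (i <= j)%N -> p j -> p i) ->
  exists2 r, (r <= k)%N & forall i : 'I_k, p i = (i < r)%N.
Proof.
(* The bound [r] will be the least [m] from which on [p] fails; [q k] holds vacuously, whence
   [r <= k]. *)
move=> p_down; pose q m := [forall i : 'I_k, (m <= i)%N ==> ~~ p i].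
have exq : exists m, q m.
  by exists k; apply/forallP => i; rewrite leqNgt ltn_ord.
case: (ex_minnP exq) => r /forallP qr r_min; exists r.
  by apply: r_min; apply/forallP => i; rewrite leqNgt ltn_ord.
move=> i; case: ltnP => [lt_ir|le_ri]; last first.
  by apply/negbTE; have := qr i; rewrite le_ri.
apply: contraLR lt_ir => npi; rewrite -leqNgt; apply: r_min.
by apply/forallP => j; apply/implyP => le_ij; apply: contra npi; apply: p_down.
Qed.

Section Phi.
Variables (R : realType) (k : nat).
Implicit Types (v n : 'rV[R]_k) (w a b : 'cV[int]_k).

Lemma phiE v w : phi v w = \sum_i v 0 i * (w i 0)%:~R.
Proof. by rewrite /phi mxE; apply: eq_bigr => i _; rewrite mxE. Qed.

Lemma phi_zmod_morphism v : zmod_morphism (phi v).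
Proof. by move=> x y; rewrite /phi map_mxB mulmxBr !mxE. Qed.

Lemma phiD v : {morph phi v : x y / x + y}.
Proof. by move=> x y; rewrite /phi map_mxD mulmxDr mxE. Qed.

Lemma phi_delta v (i : 'I_k) (z : int) : phi v (z *: delta_mx i 0) = v 0 i * z%:~R.
Proof.
rewrite phiE (bigD1 i) //= big1 ?addr0 => [|j ji]; rewrite !mxE.
  by rewrite !eqxx mulr1.
by rewrite (negbTE ji) mulr0 mulr0.
Qed.

Lemma phi_col_perm (c : R) (s : 'S_k) v w :
  phi (c *: col_perm s v) w = c * phi v (row_perm s^-1 w).
Proof.
rewrite !phiE mulr_sumr [RHS](reindex_inj (@perm_inj _ s)) /=.
by apply: eq_bigr => i _; rewrite !mxE permK mulrA.
Qed.

Lemma phi_ge_term v w (i : 'I_k) :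
    (forall j, 0 <= v 0 j) -> (forall j, 0 <= w j 0) ->
  v 0 i * (w i 0)%:~R <= phi v w.
Proof.
move=> v0 w0; rewrite phiE (bigD1 i) //= lerDl sumr_ge0 // => j _.
by rewrite mulr_ge0 ?ler0z.
Qed.

Lemma phi_trace v : (forall i, 0 <= v 0 i) -> v != 0 -> trace (@cV_le k) (phi v).
Proof.
move=> v0 vN0; split; first exact: phi_zmod_morphism.
  case/rV0Pn: vN0 => i vi; exists (1 *: delta_mx i 0).
  by rewrite phi_delta mulr1.
move=> w /forallP w0; rewrite phiE sumr_ge0 // => i _.
by rewrite mulr_ge0 // ler0z; have := w0 i; rewrite mxE.
Qed.

(** Permuting the weights amounts to permuting coordinates, which preserves order units and order
    intervals; a positive factor cancels from all conditions. *)
Lemma good_col_perm (c : R) (s : 'S_k) v :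
    0 < c -> order_unit_good (@cV_le k) (phi v) ->
  order_unit_good (@cV_le k) (phi (c *: col_perm s v)).
Proof.
move=> c0 good b /cV_order_unitP b0 a'.
rewrite !phi_col_perm pmulr_rge0 // ler_pM2l // => a'b.
have ub : order_unit (@cV_le k) (row_perm s^-1 b).
  by apply/cV_order_unitP => i; rewrite mxE.
have [a [/forallP a0 /forallP ab aE]] := good _ ub _ a'b.
exists (row_perm s a); split.
- by apply/forallP => i; have := a0 (s i); rewrite !mxE.
- by apply/forallP => i; have := ab (s i); rewrite !mxE permK.
- by rewrite phi_col_perm -row_permM mulVg row_perm1 aE.
Qed.

Lemma good_col_permP (c : R) (s : 'S_k) v :
    0 < c ->
  order_unit_good (@cV_le k) (phi (c *: col_perm s v)) <->
  order_unit_good (@cV_le k) (phi v).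
Proof.
move=> c0; split; last exact: good_col_perm.
have ci0 : 0 < c^-1 by rewrite invr_gt0.
move=> /(good_col_perm _ s^-1%g _ ci0); congr (order_unit_good _ (phi _)).
by apply/rowP => i; rewrite !mxE permKV mulKf // gt_eqF.
Qed.

Lemma slow_growth_good n :
    (forall i, n 0 i \is a Num.nat) ->
    (forall j, n 0 j <= 1 + \sum_(i < k | (i < j)%N) n 0 i) ->
  order_unit_good (@cV_le k) (phi n).
Proof.
move=> n_nat slow b /cV_order_unitP b0 a' /andP[a'0 a'b].
(* Weights and bounds are extended by [0] beyond ['I_k]; truncation and absolute value lose nothing
   on natural weights and positive bounds. *)
pose N m := oapp (fun i : 'I_k => Num.truncn (n 0 i)) 0%N (insub m).
pose B m := oapp (fun i : 'I_k => absz (b i 0)) 0%N (insub m).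
have NE (i : 'I_k) : n 0 i = (N i)%:R by rewrite /N valK /= truncnK.
have BE (i : 'I_k) : b i 0 = B i by rewrite /B valK /= gtz0_abs.
have [m mE] : exists m, phi n a' = m%:R.
  apply/natrP; rewrite natrEint a'0 andbT phiE rpred_sum // => i _.
  by rewrite rpredM ?intr_int // intr_nat.
have bE : phi n b = (\sum_(i < k) N i * B i)%N%:R.
  by rewrite phiE natr_sum; apply: eq_bigr => i _; rewrite NE BE natrM.
have [|||a [aB am]] := bounded_change N B k _ _ m.
- by move=> i ik; have := b0 (Ordinal ik); rewrite BE ltz_nat.
- move=> j jk; have := slow (Ordinal jk).
  rewrite (eq_bigr _ (fun i _ => NE i)) NE /= -natr_sum nat1r ler_nat add1n.
  by rewrite (big_ord_widen k N) // ltnW.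
- by move: a'b; rewrite mE bE ler_nat.
exists (\col_i (a i)%:Z); split.
- by apply/forallP => i; rewrite !mxE.
- by apply/forallP => i; rewrite !mxE BE lez_nat.
rewrite mE -am phiE natr_sum; apply: eq_bigr => i _.
by rewrite mxE NE natrM.
Qed.

(** With [b = (1, ..., 1)] the witness is a 0/1 vector, so the values attained are subsums of the
    weights. *)
Lemma good_const1 n :
    order_unit_good (@cV_le k) (phi n) ->
  forall a', 0 <= phi n a' <= \sum_i n 0 i ->
  exists a, [/\ forall i, 0 <= a i 0, forall i, a i 0 <= 1 &
                phi n a = phi n a'].
Proof.
move=> good a' a'P; have [||a [/forallP a0 /forallP a1 aE]] := good (const_mx 1) _ a'.
- by apply/cV_order_unitP => i; rewrite mxE.
- rewrite [phi n (const_mx 1)]phiE; under eq_bigr do rewrite mxE mulr1.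
  exact: a'P.
by exists a; split=> // i; [have := a0 i | have := a1 i]; rewrite !mxE.
Qed.

Lemma good_nat n (i0 : 'I_k) :
    (forall i, n 0 i != 0 -> 1 <= n 0 i) -> n 0 i0 = 1 ->
    (forall i, 0 <= n 0 i) ->
    order_unit_good (@cV_le k) (phi n) ->
  forall j, n 0 j \is a Num.nat.
Proof.
move=> n_ge1 n1 n0 good j; rewrite natrEint n0 andbT.
(* The value of [a'] is the fractional part of [n 0 j]. *)
pose a' : 'cV[int]_k := 1 *: delta_mx j 0 - Num.floor (n 0 j) *: delta_mx i0 0.
have a'E : phi n a' = n 0 j - (Num.floor (n 0 j))%:~R.
  by rewrite phi_zmod_morphism !phi_delta n1 mul1r mulr1.
have a'lt1 : phi n a' < 1.
  by rewrite a'E ltrBlDr addrC; have := floorD1_gt (n 0 j); rewrite intrD.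
have [|a [a0 a1 aE]] := good_const1 n good a'.
  rewrite {1}a'E subr_ge0 floor_le_tmp; apply: (le_trans (ltW a'lt1)).
  by rewrite (bigD1 i0) //= n1 lerDl sumr_ge0.
suff : phi n a = 0.
  rewrite aE a'E => /eqP; rewrite subr_eq0 => /eqP ->; exact: intr_int.
(* A single nonzero term would already push the value of [a] up to at least 1. *)
rewrite phiE big1 // => i _; apply/eqP; apply: contraTT a'lt1.
rewrite -leNgt -aE mulf_eq0 negb_or intr_eq0 => /andP[ni ai].
apply: le_trans (phi_ge_term n a i n0 a0).
have ai1 : 1 <= a i 0 by rewrite -gtz0_ge1 lt_def ai a0.
by rewrite -[leLHS]mulr1 ler_pM // ?n_ge1 // ler1z.
Qed.

Lemma good_slow n (i0 j : 'I_k) :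
    (forall i, 0 <= n 0 i) -> n 0 i0 = 1 ->
    (forall i : 'I_k, (j <= i)%N -> n 0 i != 0 -> n 0 j <= n 0 i) ->
    order_unit_good (@cV_le k) (phi n) ->
  n 0 j <= 1 + \sum_(i < k | (i < j)%N) n 0 i.
Proof.
move=> n0 n1 n_mono good; rewrite leNgt; apply/negP => fast.
(* When [i0 < j], the entry at [i0] is 2, so [a'] itself is not below [(1, ..., 1)]. *)
pose a' : 'cV[int]_k := 1 *: delta_mx i0 0 + \col_(i < k) ((i < j)%N : nat)%:Z.
have a'E : phi n a' = 1 + \sum_(i < k | (i < j)%N) n 0 i.
  rewrite phiD phi_delta n1 mulr1 phiE; congr (_ + _).
  rewrite [RHS]big_mkcond; apply: eq_bigr => i _; rewrite mxE.
  by case: ifP => _; rewrite ?mulr1 ?mulr0.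
have [|a [a0 a1 aE]] := good_const1 n good a'.
  rewrite a'E addr_ge0 ?sumr_ge0 //=; apply: (le_trans (ltW fast)).
  by rewrite (bigD1 j) //= lerDl sumr_ge0.
suff : phi n a <= \sum_(i < k | (i < j)%N) n 0 i.
  by rewrite aE a'E gerDr ler10.
rewrite phiE [leRHS]big_mkcond; apply: ler_sum => i _.
case: ltnP => [_|le_ji]; first by rewrite ler_piMr // lerz1.
have [->|ni] := eqVneq (n 0 i) 0; first by rewrite mul0r.
have [->|ai] := eqVneq (a i 0) 0; first by rewrite mulr0.
have ai1 : 1 <= a i 0 by rewrite -gtz0_ge1 lt_def ai a0.
(* A nonzero term at an index [i >= j] contributes at least [n 0 j], which [fast] forbids. *)
have : n 0 j <= phi n a.
  apply: le_trans (phi_ge_term n a i n0 a0).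
  by apply: (le_trans (n_mono i le_ji ni)); rewrite ler_peMr // ler1z.
by rewrite aE a'E leNgt fast.
Qed.

End Phi.

Theorem propositionA3 (R : realType) (k : nat) (v : 'rV[R]_k)
    (v_ge0 : forall i, 0 <= v 0 i) (v_neq0 : v != 0) :
  order_unit_good_trace (@cV_le k) (phi v) <->
  exists (c : R) (s : 'S_k) (r : nat),
    [/\ 0 < c,
        normal_form (c *: col_perm s v) r &
        slow_growth (c *: col_perm s v) r].
Proof.
split=> [[_ good]|[c [s [r [c0 [_ [nN0 n0 _]] [n_nat n1 slow]]]]]]; last first.
  split; first exact: phi_trace.
  apply/(good_col_permP _ _ c s v c0); apply: slow_growth_good => j.
    by have [/n_nat //|/n0 ->] := ltnP j r; rewrite rpred0.
  (* [slow_growth] gives the bound only for [0 < j < r]; elsewhere the entry is 1 or 0 and the bound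
     follows from nonnegativity of the sum. *)
  have sum_ge0 : 0 <= \sum_(i < k | (i < j)%N) (c *: col_perm s v) 0 i.
    by apply: sumr_ge0 => i _; rewrite !mxE mulr_ge0 // ltW.
  have [j0|j_gt0] := posnP j; first by rewrite n1 // lerDl.
  have [jr|/n0 ->] := ltnP j r; first by apply: slow; rewrite j_gt0.
  by rewrite addr_ge0.
(* This preorder puts nonzero entries first, in increasing order, and all zeros last. *)
pose e := [rel i j : 'I_k | (v 0 j == 0) || (v 0 i != 0) && (v 0 i <= v 0 j)].
have [s s_sorted] : exists s : 'S_k, forall i j : 'I_k, (i <= j)%N -> e (s i) (s j).
  apply: (sorting_perm k e) => [i j|j i l] /=.
    by case: eqP; case: eqP => //= _ _; apply: le_total.
  case: (v 0 l == 0) => //=; case: (v 0 j =P 0) => //= _.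
  by move=> /andP[-> ij] jl; apply: le_trans jl.
have [r rk rE] : exists2 r, (r <= k)%N &
    forall i : 'I_k, (v 0 (s i) != 0) = (i < r)%N.
  apply: initial_segmentP => i j ij vj.
  by have := s_sorted _ _ ij; rewrite /= (negbTE vj) => /andP[].
have s_mono (i j : 'I_k) : (i <= j)%N -> v 0 (s j) != 0 -> v 0 (s i) <= v 0 (s j).
  by move=> ij vj; have := s_sorted _ _ ij; rewrite /= (negbTE vj) => /andP[].
have r_gt0 : (0 < r)%N.
  case/rV0Pn: v_neq0 => l; rewrite -(permKV s l) rE.
  exact: leq_ltn_trans.
pose i0 : 'I_k := Ordinal (leq_trans r_gt0 rk).
have vi0 : 0 < v 0 (s i0) by rewrite lt_def v_ge0 rE r_gt0.
(* Rescaling makes the least nonzero weight equal to 1. *)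
pose c := (v 0 (s i0))^-1.
have c_gt0 : 0 < c by rewrite invr_gt0.
exists c, s, r.
have {}good := good_col_perm _ _ c s v c_gt0 good.
set n := c *: col_perm s v in good *.
have nE i : n 0 i = c * v 0 (s i) by rewrite !mxE.
have n_ge0 i : 0 <= n 0 i by rewrite nE mulr_ge0 // ltW.
have n_neq0 i : (n 0 i != 0) = (i < r)%N.
  by rewrite nE mulf_eq0 (gt_eqF c_gt0) rE.
have n_mono (i j : 'I_k) : (i <= j)%N -> n 0 j != 0 -> n 0 i <= n 0 j.
  by move=> ij; rewrite n_neq0 !nE ler_pM2l // -rE; apply: s_mono.
have n1 : n 0 i0 = 1 by rewrite nE mulVf // gt_eqF.
split=> //.
  split=> //; split=> [i|i|i j ji jr]; first by rewrite n_neq0.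
    by move=> ri; apply/eqP; rewrite -[_ == _]negbK n_neq0 -leqNgt.
  by apply: n_mono; rewrite ?n_neq0 // ji.
split=> [i _|i i_0|j _].
- by apply: (good_nat _ _ n i0) => // l nl; rewrite -n1; apply: n_mono.
- by rewrite (_ : i = i0) //; apply: val_inj.
- by apply: (good_slow _ _ n i0) => // i; apply: n_mono.
Qed.
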